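(* Let $N$ be a Nijenhuis operator on a Poisson manifold $(\mathsf M,\mathcal P)$. Assume that the operators $\mathrm{Id},N,\dots,N^{n-1}$ are linearly independent at each point of $\mathsf M$ and that $n$ is the maximal number with this property, so that for every $k\ge n$ the operator $N^k$ is a linear combination of $\mathrm{Id},N,\dots,N^{n-1}$ with functional coefficients. Let $$\mathcal S(N)=\Big\{Q=\sum_{k=1}^n h_kN^{k-1}\ \Big|\ h_k\in C^\infty(\mathsf M),\ \langle Q,N\rangle=0\Big\}.$$ Let $Q_1,\dots,Q_n\in\mathcal S(N)$ be a basis of $\mathcal S(N)$ in the sense that every $Q\in\mathcal S(N)$ can be written as a linear combination $Q=\sum_i f_iQ_i$ with $f_i\in C^\infty(\mathsf M)$. Suppose that $N$ is self-adjoint with respect to $\mathcal P$, that is, $\mathcal P(\alpha,N^*\beta)=\mathcal P(N^*\alpha,\beta)$ for all $\alpha,\beta\in T^*_x\mathsf M$, $x\in\mathsf M$. Then for any $Q\in\mathcal S(N)$, the coefficients $f_1,\dots,f_n$ of the expansion $Q=\sum_i f_iQ_i$ Poisson commute with respect to $\mathcal P$.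
   Context: An operator field is a smooth tensor field of type $(1,1)$. It is a Nijenhuis operator if $N^2[\xi,\eta]+[N\xi,N\eta]-N[N\xi,\eta]-N[\xi,N\eta]=0$ for all vector fields $\xi,\eta$. For commuting operator fields $A,B$, the $(1,2)$-tensor $\langle A,B\rangle$ is $$\langle A,B\rangle(\xi,\eta)=AB[\xi,\eta]+[A\xi,B\eta]-A[\xi,B\eta]-B[A\xi,\eta].$$ Commuting $A,B$ with $\langle A,B\rangle=0$ are called strong symmetries of each other. $N^*$ is the dual operator on covectors, $(N^*\alpha)(\xi)=\alpha(N\xi)$. The Poisson structure $\mathcal P$ is a bivector viewed as a skew-symmetric bilinear form on covectors, and $\{f,g\}=\mathcal P(\mathrm d f,\mathrm d g)$. *)

(* Defs.v *)
From HB Require Import structures.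
From mathcomp Require Import all_boot all_order all_algebra.
From mathcomp Require Import all_classical all_reals all_analysis.
Set Implicit Arguments.
Unset Strict Implicit.
Unset Printing Implicit Defensive.
Import Order.TTheory GRing.Theory Num.Theory.
Import numFieldNormedType.Exports.
Local Open Scope classical_set_scope.
Local Open Scope ring_scope.

Fixpoint differentiable_upto (R : realType) (V W : normedModType R) (k : nat)
    (D : set V) (f : V -> W) : Prop :=
  if k is k'.+1 then
    (forall x, D x -> differentiable f x) /\
    (forall v, differentiable_upto k' D (fun x => 'D_v f x))
  else True.

(* C^oo on D; meant for open D, so that only the values of f on D matter. *)
Definition smooth_on (R : realType) (V W : normedModType R)
    (D : set V) (f : V -> W) : Prop :=
  forall k, differentiable_upto k D f.

(* A smooth d-manifold (Hausdorff, second countable) with a smooth atlas. The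
   chart with index i is the homeomorphism chart_map i from the open set dom i
   onto the open set chart_map i @` dom i of R^d; its inverse is chart_inv i.
   Both maps are total functions, with irrelevant values outside these sets. *)
Record manifold (R : realType) (d : nat) := Manifold {
  carrier :> topologicalType;
  chart : Type;
  dom : chart -> set carrier;
  chart_map : chart -> carrier -> 'cV[R]_d;
  chart_inv : chart -> 'cV[R]_d -> carrier;
  chart_at : carrier -> chart;
  manifold_hausdorff : hausdorff_space carrier;
  manifold_second_countable : @second_countable carrier;
  dom_chart_at : forall p, dom (chart_at p) p;
  dom_open : forall i, open (dom i);
  img_open : forall i, open (chart_map i @` dom i);
  chart_mapK : forall i p, dom i p -> chart_inv i (chart_map i p) = p;
  chart_map_continuous : forall i p, dom i p ->
    {for p, continuous (chart_map i)};
  chart_inv_continuous : forall i p, dom i p ->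
    {for chart_map i p, continuous (chart_inv i)};
  transition_smooth : forall i j,
    smooth_on (chart_map i @` (dom i `&` dom j)) (chart_map j \o chart_inv i)
}.

Arguments chart {R d} m.
Arguments dom {R d m}.
Arguments chart_map {R d m}.
Arguments chart_inv {R d m}.
Arguments chart_at {R d m}.

Section Manifold.
Variables (R : realType) (d : nat) (M : manifold R d).

Definition smooth_fun (f : M -> R) : Prop :=
  forall i : chart M,
    smooth_on (chart_map i @` dom i) (f \o chart_inv i : 'cV[R]_d -> R^o).

(* Tensor fields are given by their components in all charts: T i p is the
   value at p in the chart i, and is relevant only when dom i p. Vectors are
   columns, covectors are rows, operators are square matrices acting on columns
   from the left, and bivectors are matrices of bilinear forms on rows. *)
Definition components (V : Type) := chart M -> M -> V.
Definition vectors := components 'cV[R]_d.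
Definition operators := components 'M[R]_d.
Definition bivectors := components 'M[R]_d.

Definition smooth_components (V : normedModType R) (T : components V) : Prop :=
  forall i, smooth_on (chart_map i @` dom i) (fun y => T i (chart_inv i y)).

Definition jacobian_at (i j : chart M) (p : M) : 'M[R]_d :=
  \matrix_(k, l)
    ('D_(delta_mx l 0) (chart_map j \o chart_inv i) (chart_map i p)
      : 'cV[R]_d) k 0.

Definition vector_field (X : vectors) : Prop :=
  smooth_components X /\
  forall i j p, dom i p -> dom j p -> X j p = jacobian_at i j p *m X i p.

Definition operator_field (A : operators) : Prop :=
  smooth_components A /\
  forall i j p, dom i p -> dom j p ->
    A j p *m jacobian_at i j p = jacobian_at i j p *m A i p.

Definition bivector_field (P : bivectors) : Prop :=
  [/\ smooth_components P,
      forall i j p, dom i p -> dom j p ->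
        P j p = jacobian_at i j p *m P i p *m (jacobian_at i j p)^T
    & forall i p, dom i p -> (P i p)^T = - P i p].

Definition same_field V (S T : components V) : Prop :=
  forall i p, dom i p -> S i p = T i p.

Definition op_apply (A : operators) (X : vectors) : vectors :=
  fun i p => A i p *m X i p.

Definition op_pow (A : operators) (k : nat) : operators :=
  fun i p => A i p ^+ k.

Definition op_comb n (h : 'I_n -> M -> R) (A : 'I_n -> operators) : operators :=
  fun i p => \sum_(k < n) h k p *: A k i p.

(* [X, Y]^k = X^l d_l Y^k - Y^l d_l X^k *)
Definition lie_bracket (X Y : vectors) : vectors := fun i p =>
  'D_(X i p) (Y i \o chart_inv i) (chart_map i p) -
  'D_(Y i p) (X i \o chart_inv i) (chart_map i p).

Definition nijenhuis (N : operators) : Prop :=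
  forall X Y, vector_field X -> vector_field Y -> forall i p, dom i p ->
    N i p ^+ 2 *m lie_bracket X Y i p
    + lie_bracket (op_apply N X) (op_apply N Y) i p
    - N i p *m lie_bracket (op_apply N X) Y i p
    - N i p *m lie_bracket X (op_apply N Y) i p = 0.

(* The tensor <A, B>, for commuting A and B. *)
Definition concomitant (A B : operators) (X Y : vectors) : vectors :=
  fun i p =>
    A i p *m B i p *m lie_bracket X Y i p
    + lie_bracket (op_apply A X) (op_apply B Y) i p
    - A i p *m lie_bracket X (op_apply B Y) i p
    - B i p *m lie_bracket (op_apply A X) Y i p.

Definition concomitant_zero (A B : operators) : Prop :=
  forall X Y, vector_field X -> vector_field Y ->
    same_field (concomitant A B X Y) (fun _ _ => 0).

Definition powers_independent (N : operators) (n : nat) : Prop :=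
  forall i p, dom i p -> free [tuple op_pow N k i p | k < n].

Definition symmetries (n : nat) (N : operators) : set operators :=
  [set Q | (exists h : 'I_n -> M -> R, (forall k, smooth_fun (h k)) /\
              same_field Q (op_comb h (fun k => op_pow N k)))
           /\ concomitant_zero Q N].

Definition symmetries_basis n (N : operators) (Q : 'I_n -> operators) : Prop :=
  (forall k, symmetries n N (Q k)) /\
  (forall S, symmetries n N S ->
     exists f : 'I_n -> M -> R,
       (forall k, smooth_fun (f k)) /\ same_field S (op_comb f Q)).

Definition dual_apply (A : operators) (i : chart M) (p : M) (a : 'rV[R]_d) :
  'rV[R]_d := a *m A i p.

Definition pairing (P : bivectors) (i : chart M) (p : M) (a b : 'rV[R]_d) : R :=
  (a *m P i p *m b^T) 0 0.

Definition differential (f : M -> R) (i : chart M) (p : M) : 'rV[R]_d :=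
  \row_k 'D_(delta_mx k 0) (f \o chart_inv i : 'cV[R]_d -> R^o) (chart_map i p).

(* Computed in one chart around p; it does not depend on this chart because of
   the transformation law of bivector fields. *)
Definition poisson_bracket (P : bivectors) (f g : M -> R) : M -> R := fun p =>
  pairing P (chart_at p) p
    (differential f (chart_at p) p) (differential g (chart_at p) p).

Definition poisson_structure (P : bivectors) : Prop :=
  bivector_field P /\
  forall f g h, smooth_fun f -> smooth_fun g -> smooth_fun h -> forall p,
    poisson_bracket P f (poisson_bracket P g h) p
    + poisson_bracket P g (poisson_bracket P h f) p
    + poisson_bracket P h (poisson_bracket P f g) p = 0.

Definition self_adjoint (P : bivectors) (N : operators) : Prop :=
  forall i p, dom i p -> forall a b : 'rV[R]_d,
    pairing P i p a (dual_apply N i p b) = pairing P i p (dual_apply N i p a) b.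

End Manifold.

(* Main.v *)
(** An operator [Q = sum_k h_k N^(k-1)] satisfies [<Q, N> = 0] iff
    [sum_k dh_k (x) N^k = sum_k N^* dh_k (x) N^(k-1)]. For [Q = sum_i f_i Q_i]
    with the [Q_i] themselves symmetries, Leibniz' rule gives in the same way
    [sum_i df_i (x) N Q_i = sum_i N^* df_i (x) Q_i]. Expanding [Q_i] in powers
    of [N] turns this into [N^* a_l = a_(l-1) + c_l a_n], where [N^n] has
    coefficients [c_l] and the [a_l] are pointwise combinations of the [df_i].
    Hence every [a_l] is a polynomial in [N^*] applied to [a_n], and such
    covectors are pairwise [P]-orthogonal because [P] is skew and [N] is
    self-adjoint. Since [N] is Nijenhuis, its powers are symmetries, so they are
    combinations of the [Q_i], and conversely the [df_i] are combinations of the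
    [a_l].

    The concomitant is only tested on global vector fields; that these take all
    values at a given point needs smooth bump functions. *)
Require Import Defs.
From HB Require Import structures.
From mathcomp Require Import all_boot all_order all_algebra.
From mathcomp Require Import all_classical all_reals all_analysis.
From mathcomp Require Import ring.
Set Implicit Arguments.
Unset Strict Implicit.
Unset Printing Implicit Defensive.
Import Order.TTheory GRing.Theory Num.Theory.
Import numFieldNormedType.Exports.
Local Open Scope classical_set_scope.
Local Open Scope ring_scope.

(** * Calculus of smooth maps *)

Section DifferentiableUpto.
Variables (R : realType) (V : normedModType R).
Implicit Types (D E : set V) (W : normedModType R) (k : nat).

(** The first-order expansion of [f] at [x] is also one of [g], and uniqueness of the differential
    then gives differentiability. *)
Lemma near_eq_differentiable W (f g : V -> W) (x : V) :
  (\near x, f x = g x) -> differentiable f x -> differentiable g x.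
Proof.
move=> fg /diff_locallyP [dfc dfE].
have gE : g \o shift x = cst (g x) + 'd f x +o_ 0 id.
  apply/eqaddoP => e e0; move/eqaddoP: dfE => /(_ e e0); apply: filter_app.
  have : \forall y \near (0 : V), f (y + x) = g (y + x).
    by have := fg; rewrite (near_shift 0 x) /= subr0.
  apply: filter_app; near=> y => /= fgy.
  by rewrite /= !fctE /= fgy (nbhs_singleton fg).
by apply/diff_locallyP; rewrite (diff_unique dfc gE).
Unshelve. all: by end_near. Qed.

(** The condition is pointwise in [D], so [E] may vary with [x]: a map can be checked on different
    sets around different points. *)
Lemma differentiable_upto_local W k D (f : V -> W) :
  (forall x, D x -> exists2 E, E x & differentiable_upto k E f) ->
  differentiable_upto k D f.
Proof.
elim: k f => //= k IH f loc; split=> [x /loc[E Ex [df _]]|v]; first exact: df.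
by apply: IH => x /loc[E Ex [_ ddf]]; exists E.
Qed.

Lemma differentiable_uptoW W k D (f : V -> W) :
  differentiable_upto k.+1 D f -> differentiable_upto k D f.
Proof.
elim: k f => //= k IH f [df ddf]; split=> // v.
exact/IH/ddf.
Qed.

Section Open.
Variables (D : set V) (oD : open D).

(** Openness of [D] turns equality on [D] into equality near each of its points, so the directional
    derivatives agree on [D] as well and the induction continues. *)
Lemma differentiable_upto_eq W k (f g : V -> W) :
  (forall x, D x -> f x = g x) ->
  differentiable_upto k D f -> differentiable_upto k D g.
Proof.
elim: k f g => //= k IH f g fg [df ddf].
have nfg x : D x -> \near x, f x = g x.
  by move=> Dx; apply: filterS (open_nbhs_nbhs (conj oD Dx)) => y /fg.
split=> [x Dx|v]; first exact: near_eq_differentiable (nfg x Dx) (df x Dx).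
by apply: IH (ddf v) => x Dx; apply: near_eq_derive; exact: nfg.
Qed.

Lemma differentiable_upto_cst W k (w : W) : differentiable_upto k D (cst w).
Proof.
elim: k w => //= k IH w; split=> // v.
by apply: differentiable_upto_eq (IH 0) => x _; rewrite derive_cst.
Qed.

Lemma differentiable_uptoD W k (f g : V -> W) :
  differentiable_upto k D f -> differentiable_upto k D g ->
  differentiable_upto k D (fun x => f x + g x).
Proof.
elim: k f g => //= k IH f g [df ddf] [dg ddg]; split=> [x Dx|v].
  by apply: differentiableD; [exact: df|exact: dg].
apply: differentiable_upto_eq (IH _ _ (ddf v) (ddg v)) => x Dx.
by rewrite -deriveD//; apply: diff_derivable; [exact: df|exact: dg].
Qed.

Lemma differentiable_upto_sum W k n (f : 'I_n -> V -> W) :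
  (forall i, differentiable_upto k D (f i)) ->
  differentiable_upto k D (fun x => \sum_(i < n) f i x).
Proof.
elim: n f => [|n IH] f fk.
  apply: differentiable_upto_eq (differentiable_upto_cst _ 0) => x _.
  by rewrite big_ord0.
apply: differentiable_upto_eq (differentiable_uptoD
  (IH _ (fun i => fk (widen_ord (leqnSn n) i))) (fk ord_max)) => x _.
by rewrite big_ord_recr.
Qed.

Lemma differentiable_uptoM k (f g : V -> R^o) :
  differentiable_upto k D f -> differentiable_upto k D g ->
  differentiable_upto k D (fun x => f x * g x : R^o).
Proof.
elim: k f g => [//|k IH] f g fk gk.
have [df ddf] := fk; have [dg ddg] := gk; split=> [x Dx|v].
  by apply: differentiableM; [exact: df|exact: dg].
apply: differentiable_upto_eq (differentiable_uptoD
  (IH _ _ (differentiable_uptoW fk) (ddg v))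
  (IH _ _ (differentiable_uptoW gk) (ddf v))) => x Dx.
by rewrite -deriveM//; apply: diff_derivable; [exact: df|exact: dg].
Qed.

Lemma differentiable_upto_coord m n k (f : V -> 'M[R]_(m, n)) i j :
  differentiable_upto k D f -> differentiable_upto k D (fun x => f x i j : R^o).
Proof.
elim: k f => [//|k IH] f [df ddf]; split=> [x Dx|v].
  apply: (@differentiable_comp _ _ _ _ f (fun A => A i j : R^o)).
    exact: df.
  exact: differentiable_coord.
apply: differentiable_upto_eq (IH _ (ddf v)) => x Dx.
by rewrite derive_mx ?mxE//; apply/diff_derivable/df.
Qed.

Lemma differentiable_mx m n (f : V -> 'M[R]_(m, n)) x :
  (forall i j, differentiable (fun y => f y i j : R^o) x) -> differentiable f x.
Proof.
move=> df.
have -> : f = \sum_(i < m) \sum_(j < n)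
    (fun y => (f y i j : R^o) *: (delta_mx i j : 'M[R]_(m, n))).
  apply/funext => y; rewrite fct_sumE [LHS]matrix_sum_delta.
  by apply: eq_bigr => i _; rewrite fct_sumE.
do 2![apply: differentiable_sum => ?].
exact: differentiableZl.
Qed.

Lemma differentiable_upto_mx m n k (f : V -> 'M[R]_(m, n)) :
  (forall i j, differentiable_upto k D (fun x => f x i j : R^o)) ->
  differentiable_upto k D f.
Proof.
elim: k f => [//|k IH] f fk.
have df x : D x -> differentiable f x.
  by move=> Dx; apply: differentiable_mx => i j; have [+ _] := fk i j; apply.
split=> // v; apply: IH => i j; have [_ /(_ v)] := fk i j.
apply: differentiable_upto_eq => x Dx.
by rewrite derive_mx ?mxE//; apply/diff_derivable/df.
Qed.

Lemma differentiable_uptoZ m n k (f : V -> R^o) (g : V -> 'M[R]_(m, n)) :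
  differentiable_upto k D f -> differentiable_upto k D g ->
  differentiable_upto k D (fun x => f x *: g x).
Proof.
move=> fk gk; apply: differentiable_upto_mx => i j.
apply: differentiable_upto_eq
  (differentiable_uptoM fk (differentiable_upto_coord i j gk)) => x _.
by rewrite !mxE.
Qed.

Lemma differentiable_upto_mulmx m n p k (f : V -> 'M[R]_(m, n))
    (g : V -> 'M[R]_(n, p)) :
  differentiable_upto k D f -> differentiable_upto k D g ->
  differentiable_upto k D (fun x => f x *m g x).
Proof.
move=> fk gk; apply: differentiable_upto_mx => i j.
have := @differentiable_upto_sum R^o k n (fun l x => f x i l * g x l j).
move=> /(_ _)/differentiable_upto_eq; apply=> [x _|l]; first by rewrite mxE.
by apply: differentiable_uptoM; exact: differentiable_upto_coord.
Qed.

End Open.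
End DifferentiableUpto.

Lemma derive_comp (R : realType) (U V W : normedModType R) (f : U -> V)
    (g : V -> W) x v : differentiable f x -> differentiable g (f x) ->
  'D_v (g \o f) x = 'D_('D_v f x) g (f x).
Proof.
move=> df dg; rewrite deriveE; last exact: differentiable_comp.
by rewrite diff_comp//= -(deriveE v df) -deriveE.
Qed.

Lemma differentiable_scale_mx (R : realType) (V : normedModType R) m n
    (f : V -> R^o) (g : V -> 'M[R]_(m, n)) x :
  differentiable f x -> differentiable g x ->
  differentiable (fun y => f y *: g y) x.
Proof.
move=> df dg; apply: differentiable_mx => i j.
rewrite (_ : (fun _ => _) = f * (fun y => g y i j : R^o)).
  apply: differentiableM => //.
  exact: (differentiable_comp dg (differentiable_coord _ i j)).
by apply/funext => y; rewrite mxE.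
Qed.

Lemma derive_scale_mx (R : realType) (V : normedModType R) m n
    (f : V -> R^o) (g : V -> 'M[R]_(m, n)) x v :
  differentiable f x -> differentiable g x ->
  'D_v (fun y => f y *: g y) x = f x *: 'D_v g x + 'D_v f x *: g x.
Proof.
move=> df dg.
have dfg := diff_derivable (v := v) (differentiable_scale_mx df dg).
have dg_v := diff_derivable (v := v) dg.
apply/matrixP => i j; rewrite (derive_mx dfg) (derive_mx dg_v) !mxE.
rewrite (_ : (fun _ => _) = f * (fun y => g y i j : R^o)); last first.
  by apply/funext => y; rewrite mxE.
have /derivable_mxP/(_ i j) dgij := dg_v.
by rewrite (deriveM (diff_derivable df) dgij) [X in _ + X]mulrC.
Qed.

Section Composition.
Variables (R : realType) (V W : normedModType R) (D : set V) (oD : open D).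

(* Covers both [W = 'cV_d] and [W = R^o]: [c] are the coordinates in [e]. *)
Lemma differentiable_upto_comp_frame m (e : 'I_m -> W) (c : 'I_m -> W -> R^o)
    (E : set W) (f : V -> W) (g : W -> R^o) k :
  (forall w, w = \sum_(l < m) c l w *: e l) ->
  (forall l j h, differentiable_upto j D h ->
     differentiable_upto j D (fun x => c l (h x))) ->
  (forall x, D x -> E (f x)) ->
  differentiable_upto k D f -> differentiable_upto k E g ->
  differentiable_upto k D (g \o f).
Proof.
move=> ce cs DE; elim: k g => [//|k IH] g fk [dg ddg].
have [df ddf] := fk; split=> [x Dx|v].
  by apply: differentiable_comp; [exact: df|exact/dg/DE].
(* Expanding ['D_v f x] in the frame [e] writes the derivative of the composite as the sum of the
   [h l]. The induction hypothesis applies to ['D_(e l) g], with [f] weakened to order [k]. *)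
pose h l x : R^o := c l ('D_v f x) * 'D_(e l) g (f x).
have hk l : differentiable_upto k D (h l).
  apply: differentiable_uptoM => //; first exact/cs/ddf.
  exact: IH _ (differentiable_uptoW fk) (ddg (e l)).
apply: (differentiable_upto_eq oD) (differentiable_upto_sum oD hk) => x Dx.
have dfx := df x Dx; have dgx := dg _ (DE x Dx).
rewrite [RHS](derive_comp v dfx dgx) deriveE// [in RHS](ce ('D_v f x)).
rewrite linear_sum.
by apply: eq_bigr => l _; rewrite linearZ -deriveE.
Qed.

End Composition.

Lemma differentiable_upto_comp1 (R : realType) (V : normedModType R)
    (D : set V) (E : set R^o) (f : V -> R^o) (g : R^o -> R^o) k :
  open D -> (forall x, D x -> E (f x)) ->
  differentiable_upto k D f -> differentiable_upto k E g ->
  differentiable_upto k D (g \o f).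
Proof.
move=> oD; apply: (@differentiable_upto_comp_frame _ V R^o D oD 1
  (fun=> 1 : R^o) (fun=> id) E f g k) => // w.
by rewrite big_ord1 /GRing.scale /= mulr1.
Qed.

Lemma differentiable_upto_comp (R : realType) (V : normedModType R) d
    (D : set V) (E : set 'cV[R]_d) (f : V -> 'cV[R]_d) (g : 'cV[R]_d -> R^o) k :
  open D -> (forall x, D x -> E (f x)) ->
  differentiable_upto k D f -> differentiable_upto k E g ->
  differentiable_upto k D (g \o f).
Proof.
move=> oD; apply: (@differentiable_upto_comp_frame _ _ _ _ oD d
  (fun l => delta_mx l 0) (fun l w => w l 0)) => [w|l j h].
  by rewrite [LHS]matrix_sum_delta; apply: eq_bigr => l _; rewrite big_ord1.
exact: differentiable_upto_coord.
Qed.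

Lemma differentiable_upto_comp_mx (R : realType) (V : normedModType R) d m n
    (D : set V) (E : set 'cV[R]_d) (f : V -> 'cV[R]_d)
    (g : 'cV[R]_d -> 'M[R]_(m, n)) k :
  open D -> open E -> (forall x, D x -> E (f x)) ->
  differentiable_upto k D f -> differentiable_upto k E g ->
  differentiable_upto k D (g \o f).
Proof.
move=> oD oE DE fk gk; apply: differentiable_upto_mx => // i j.
apply: (@differentiable_upto_comp _ _ _ _ E f (fun y => g y i j)) => //.
exact: differentiable_upto_coord.
Qed.

(** * Bump functions *)

Section FlatFunction.
Variable R : realType.
Implicit Types (p : {poly R}) (x t : R).

(* These functions are closed under differentiation, and [flat 1] is the
   classical smooth function that vanishes exactly on the nonpositive reals. *)
Definition flat p (x : R^o) : R^o :=
  if 0 < x then p.[x^-1] * expR (- x^-1) else 0.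

(** The exponential series dominates each of its terms, here the one of degree [m]. *)
Lemma expR_decay m t : 0 < t -> t ^+ m * expR (- t) <= m`!%:R.
Proof.
move=> t0; rewrite expRN ler_pdivrMr ?expR_gt0//.
case: m => [|m]; first by rewrite fact0 mul1r expr0 -expR0 ler_expR ltW.
rewrite mulrC -ler_pdivrMr ?ltr0n ?fact_gt0//.
by apply: le_trans (expR_ge1Dxn m (ltW t0)); rewrite lerDr.
Qed.

(** The extra power of [t] makes the induction on [p] close: a factor ['X] is absorbed by raising
    [m]. *)
Lemma poly_expR_decay p m :
  exists C, forall t, 0 < t -> `|p.[t] * t ^+ m * expR (- t)| <= C.
Proof.
elim/poly_ind: p m => [|p c IH] m.
  by exists 0 => t _; rewrite horner0 !mul0r normr0.
have [C HC] := IH m.+1; exists (C + `|c| * m`!%:R) => t t0.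
rewrite hornerMXaddC !mulrDl -(mulrA p.[t]) -exprS.
apply: le_trans (ler_normD _ _) _; apply: lerD; first exact: HC.
rewrite -mulrA normrM ler_wpM2l// ger0_norm ?expR_decay//.
by rewrite mulr_ge0 ?expR_ge0 ?exprn_ge0 ?ltW.
Qed.

(** The decay estimate with [m = 2] at [x^-1]. A bound of second order is what makes the derivative
    at the origin vanish. *)
Lemma flat_bound p : exists2 C, 0 < C & forall x, `|flat p x| <= C * `|x| ^+ 2.
Proof.
have [C HC] := poly_expR_decay p 2.
have C0 : 0 <= C by apply: le_trans (HC 1 ltr01).
exists (C + 1) => [|x]; first by rewrite ltr_wpDl.
rewrite /flat; case: ifPn => [x0|_].
  apply: (@le_trans _ _ (C * `|x| ^+ 2)); last first.
    by rewrite ler_wpM2r ?lerDl ?exprn_ge0.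
  have := HC x^-1; rewrite invr_gt0 => /(_ x0).
  rewrite (gtr0_norm x0) -ler_pdivrMr ?exprn_gt0// -exprVn.
  apply: le_trans; rewrite -[X in _ * X]gtr0_norm ?exprn_gt0 ?invr_gt0//.
  by rewrite -normrM mulrAC.
by rewrite normr0 mulr_ge0 ?exprn_ge0 ?addr_ge0.
Qed.

(** For positive [x] the chain rule gives the factor [x^-2] times
    [p - p^]()[at]x^-1[, whence the polynomial]'X^2 * (p - p^[())]. At the origin [flat_bound]
    bounds the difference quotient by a constant times the increment. *)
Lemma is_derive_flat p (x : R^o) :
  is_derive x (1 : R^o) (flat p) (flat ('X^2 * (p - p^`())) x).
Proof.
have [x0|x0|->] := ltgtP x 0.
- rewrite {2}/flat ltNge (ltW x0) /=.
  apply: (@near_eq_is_derive _ R^o R^o (cst 0)).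
    near=> y; rewrite /flat ltNge ifF//; apply/negbTE; rewrite negbK ltW//.
    by near: y; exact: lt_nbhsl.
- rewrite {2}/flat x0.
  apply: (@near_eq_is_derive _ R^o R^o (fun y => p.[y^-1] * expR (- y^-1))).
    near=> y; rewrite /flat ifT//.
    by near: y; exact: lt_nbhsr.
  have xn0 : x != 0 by rewrite gt_eqF.
  have dV : is_derive x (1 : R) (fun y : R => y^-1) (- x ^- 2 * 1).
    exact: is_deriveV.
  have dp : is_derive x (1 : R) (horner p \o GRing.inv)
      (p^`().[x^-1] * (- x ^- 2 * 1)).
    exact: is_derive1_comp.
  have de : is_derive x (1 : R) (expR \o (fun y : R => - y^-1))
      (expR (- x^-1) * - (- x ^- 2 * 1)).
    apply: is_derive1_comp.
  apply: is_derive_eq (is_deriveM dp de) _.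
  rewrite /GRing.scale/= !hornerE /=; field.
  exact: xn0.
- rewrite {2}/flat ltxx.
  have flat0 : flat p 0 = 0 by rewrite /flat ltxx.
  suff cvg0 :
      (fun h : R => h^-1 *: ((flat p \o shift 0) (h *: (1 : R^o)) - flat p 0))
      @ 0^' --> (0 : R^o).
    by apply: DeriveDef; [apply/cvg_ex; exists 0|exact: cvg_lim].
  have [C C0 HC] := flat_bound p.
  apply/cvgrPdist_le => e e0; near=> h.
  rewrite flat0 /= subr0 addr0 sub0r normrN /GRing.scale /= mulr1.
  have h0 : h != 0 by near: h; exact: nbhs_dnbhs_neq.
  rewrite normrM normfV ler_pdivrMl ?normr_gt0//.
  apply: le_trans (HC h) _; rewrite expr2 mulrCA ler_wpM2l//.
  rewrite -ler_pdivlMl//; near: h.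
  by apply: dnbhs0_le; rewrite mulr_gt0 ?invr_gt0.
Unshelve. all: by end_near. Qed.

Lemma flatZ c p x : flat (c *: p) x = c * flat p x.
Proof. by rewrite /flat; case: ifP; rewrite ?mulr0// hornerZ mulrA. Qed.

Lemma derive_flat p v x :
  'D_(v : R^o) (flat p) x = flat (v *: ('X^2 * (p - p^`()))) x.
Proof.
have dfx := is_derive_flat p x.
have df : differentiable (flat p) x by apply/derivable1_diffP; exact: ex_derive.
rewrite deriveE// -[v]mulr1 linearZ -deriveE// derive_val mulr1 flatZ.
by [].
Qed.

Lemma differentiable_upto_flat p k : differentiable_upto k setT (flat p).
Proof.
elim: k p => // k IH p; split=> [x _|v].
  by apply/derivable1_diffP; have dfx := is_derive_flat p x; exact: ex_derive.
by rewrite (funext (derive_flat p v)).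
Qed.

Lemma flat1_gt0 x : 0 < x -> 0 < flat 1 x.
Proof. by rewrite /flat => x0; rewrite x0 hornerC mul1r expR_gt0. Qed.

Lemma flat1_eq0 x : x <= 0 -> flat 1 x = 0.
Proof. by rewrite /flat leNgt => /negbTE ->. Qed.

End FlatFunction.


Section Bump.
Variables (R : realType) (d : nat).
Implicit Types (a y : 'cV[R]_d) (r : R).

(** A sum of squares is used, and not the sup norm of matrices, to keep the function smooth. *)
Definition bumpfun a r y : R^o :=
  flat 1 (r ^+ 2 - \sum_(l < d) (y l 0 - a l 0) ^+ 2).

(** The closed sup-norm ball, stated by coordinates: it contains the support of [bumpfun a r] for
    positive [r], and is compact as a product of segments. *)
Definition box a r : set 'cV[R]_d := [set y | forall l, `|y l 0 - a l 0| <= r].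

Lemma differentiable_upto_bump a r k : differentiable_upto k setT (bumpfun a r).
Proof.
have oT := @openT 'cV[R]_d.
(* The argument of [flat] is rewritten with sums and products only, to match the closure lemmas. *)
have := @differentiable_upto_comp1 R 'cV[R]_d setT setT
  (fun y => r ^+ 2 + -1 * \sum_(l < d) (y l 0 - a l 0) * (y l 0 - a l 0))
  (flat 1) k.
move=> /(_ oT) H.
apply: differentiable_upto_eq (H _ _ _) => //.
- by move=> y _; rewrite /bumpfun /= mulN1r; do 3!congr (_ _).
- apply: differentiable_uptoD => //; first exact: differentiable_upto_cst.
  apply: differentiable_uptoM => //; first exact: differentiable_upto_cst.
  apply: differentiable_upto_sum => // l.
  have dl :
      differentiable_upto k [set: 'cV[R]_d] (fun y => y l 0 - a l 0 : R^o).
    apply: differentiable_uptoD => //; last exact: differentiable_upto_cst.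
    apply: differentiable_upto_coord => //.
    case: k {H} => // k; split=> // v.
    apply: differentiable_upto_eq (differentiable_upto_cst oT k v) => // y _.
    by rewrite derive_id.
  exact: differentiable_uptoM.
- exact: differentiable_upto_flat.
Qed.

Lemma bump_center_gt0 a r : 0 < r -> 0 < bumpfun a r a.
Proof.
move=> r0; apply: flat1_gt0; rewrite big1 ?subr0 ?exprn_gt0// => l _.
by rewrite subrr expr0n.
Qed.

Lemma bump_eq0 a r y : 0 < r -> ~ box a r y -> bumpfun a r y = 0.
Proof.
move=> r0 /existsNP[l /negP]; rewrite -ltNge => rl.
apply: flat1_eq0; rewrite subr_le0 (bigD1 l)//=.
apply: (@le_trans _ _ ((y l 0 - a l 0) ^+ 2)).
  by rewrite -[leRHS]real_normK ?num_real// lerXn2r ?nnegrE// ltW.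
by rewrite lerDl sumr_ge0// => i _; exact: sqr_ge0.
Qed.

Lemma box_compact a r : compact (box a r).
Proof.
(* Compactness of products of segments is available for row vectors, so the box is presented as a
   transposed image. *)
have -> : box a r = trmx @`
    [set x : 'rV[R]_d | forall l, `[a l 0 - r, a l 0 + r]%classic (x ord0 l)].
  apply/seteqP; split => [y ybox|_ [x xbox <-] l].
    exists y^T; last by rewrite trmxK.
    by move=> l /=; rewrite mxE in_itv /= -ler_distl; exact: ybox.
  by rewrite mxE ler_distl; have := xbox l; rewrite /= in_itv.
apply: continuous_compact; last first.
  apply: (@rV_compact _ _ (fun l => `[a l 0 - r, a l 0 + r]%classic)) => l.
  exact: segment_compact.
apply: continuous_subspaceT => x; apply: differentiable_continuous.
apply: differentiable_mx => i j.
rewrite (_ : (fun _ => _) = (fun y : 'rV[R]_d => y j i : R^o)).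
  exact: differentiable_coord.
by apply/funext => y; rewrite mxE.
Qed.

Lemma open_box (D : set 'cV[R]_d) a : open D -> D a ->
  exists2 r, 0 < r & box a r `<=` D.
Proof.
move=> oD Da; have /nbhs_ballP[e /= e0 eD] := open_nbhs_nbhs (conj oD Da).
(* Halving [e] passes from the closed box to the open ball. *)
exists (e / 2) => [|y ybox]; first by rewrite divr_gt0.
apply: eD; split => // i j; rewrite !ord1 /ball/= distrC.
by apply: le_lt_trans (ybox i) _; rewrite ltr_pdivrMr// ltr_pMr// ltr1n.
Qed.

End Bump.

(** * Extension of tangent vectors to global vector fields *)

Section Charts.
Variables (R : realType) (d : nat) (M : manifold R d).
Implicit Types (i j k : chart M) (p q : M) (U : set M).

Local Notation img i := (chart_map i @` dom i).
Local Notation trans i j := (chart_map j \o chart_inv i).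

Lemma dom_chart_inv i y : img i y -> dom i (chart_inv i y).
Proof. by move=> [p ip <-]; rewrite chart_mapK. Qed.

Lemma chart_invK i y : img i y -> chart_map i (chart_inv i y) = y.
Proof. by move=> [p ip <-]; rewrite chart_mapK. Qed.

Lemma open_chart_image i U : open U -> open (chart_map i @` (dom i `&` U)).
Proof.
move=> oU; rewrite openE => _ [p [ip Up] <-].
have img_p : nbhs (chart_map i p) (img i).
  by apply: open_nbhs_nbhs; split; [exact: img_open|exists p].
have U_p : nbhs (chart_map i p) (chart_inv i @^-1` U).
  apply: chart_inv_continuous => //; rewrite chart_mapK//.
  exact: open_nbhs_nbhs.
apply: filterS2 img_p U_p => y iy Uy.
exists (chart_inv i y); last exact: chart_invK.
by split=> //; exact: dom_chart_inv.
Qed.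

Arguments open_chart_image i {U}.

Lemma differentiable_trans i j p : dom i p -> dom j p ->
  differentiable (trans i j) (chart_map i p).
Proof.
move=> ip jp; have [+ _] := @transition_smooth _ _ M i j 1%N.
by apply; exists p.
Qed.

Lemma jacobian_atE i j p v : dom i p -> dom j p ->
  jacobian_at i j p *m v = 'D_v (trans i j) (chart_map i p).
Proof.
move=> ip jp; have df := differentiable_trans ip jp.
rewrite deriveE// [in RHS](matrix_sum_delta v) linear_sum.
apply/colP => k; rewrite mxE summxE; apply: eq_bigr => l _.
by rewrite big_ord1 linearZ -deriveE// !mxE mulrC.
Qed.

(** Cocycle rule for Jacobians: near the point, [trans i k] is the composite of [trans i j] and
    [trans j k]. *)
Lemma derive_trans_comp i j k p v : dom i p -> dom j p -> dom k p ->
  'D_v (trans i k) (chart_map i p)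
  = jacobian_at j k p *m 'D_v (trans i j) (chart_map i p).
Proof.
move=> ip jp kp.
have dij := differentiable_trans ip jp.
have djk := differentiable_trans jp kp.
have chart_ij : trans i j (chart_map i p) = chart_map j p.
  by rewrite /= chart_mapK.
have djk' : differentiable (trans j k) (trans i j (chart_map i p)).
  by rewrite chart_ij.
rewrite (jacobian_atE _ jp kp) -chart_ij -(derive_comp v dij djk').
have p_img : (chart_map i @` (dom i `&` dom j)) (chart_map i p) by exists p.
have := open_nbhs_nbhs (conj (open_chart_image i (dom_open j)) p_img).
move=> p_nbhs; apply: near_eq_derive; apply: filterS p_nbhs.
by move=> _ [q [iq jq] <-] /=; rewrite !chart_mapK.
Qed.

Lemma derive_trans_id i p v : dom i p -> 'D_v (trans i i) (chart_map i p) = v.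
Proof.
move=> ip; rewrite -[RHS](derive_id (chart_map i p) v).
have p_img : img i (chart_map i p) by exists p.
have := open_nbhs_nbhs (conj (@img_open _ _ M i) p_img).
move=> p_nbhs; apply: near_eq_derive; apply: filterS p_nbhs => y iy.
exact: chart_invK.
Qed.

(** The constant field [v] of the chart [i], cut off by a bump and pushed forward to the chart [j];
    the classical test extends it by zero outside [dom i]. *)
Definition bump_field i a r v : vectors M := fun j q =>
  (if `[< dom i q >] then bumpfun a r (chart_map i q) else 0)
    *: 'D_v (trans i j) (chart_map i q).

(** Smoothness is checked locally: on [dom i] the field is a product of smooth maps, and a point
    outside [dom i] has a neighbourhood where the field is zero. *)
Lemma bump_field_vector_field i a r v : 0 < r -> box a r `<=` img i ->
  vector_field (bump_field i a r v).
Proof.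
move=> r0 box_img; split=> [j|j k p jp kp]; last first.
  rewrite /bump_field -scalemxAr; case: asboolP => [ip|].
    by rewrite -derive_trans_comp.
  by rewrite !scale0r.
move=> n; apply: differentiable_upto_local => _ [q jq <-].
have oij := open_chart_image j (dom_open i).
have [iq|niq] := pselect (dom i q).
  exists (chart_map j @` (dom j `&` dom i)); first by exists q.
  pose h y : R^o := bumpfun a r (trans j i y).
  pose w := 'D_v (trans i j) \o trans j i.
  have tji :
      differentiable_upto n (chart_map j @` (dom j `&` dom i)) (trans j i).
    exact: transition_smooth.
  have hn : differentiable_upto n (chart_map j @` (dom j `&` dom i)) h.
    apply: (@differentiable_upto_comp _ _ _ _ setT) => //.
    exact: differentiable_upto_bump.
  have wn : differentiable_upto n (chart_map j @` (dom j `&` dom i)) w.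
    apply: (@differentiable_upto_comp_mx _ _ _ _ _ _
      (chart_map i @` (dom i `&` dom j))) => //.
    - exact/open_chart_image/dom_open.
    - by move=> _ [p [jp ip] <-] /=; rewrite chart_mapK//; exists p.
    - have [_] := @transition_smooth _ _ M i j n.+1; exact.
  apply: differentiable_upto_eq (differentiable_uptoZ oij hn wn) => //.
  move=> _ [p [jp ip] <-].
  by rewrite /bump_field /h /w /= chart_mapK// asboolT.
(* [K] contains the support. It is compact, hence closed in a Hausdorff space, so its complement is
   an open set around [q] on which the field vanishes. *)
pose K := chart_inv i @` box a r.
have cK : closed K.
  apply: compact_closed; first exact: manifold_hausdorff.
  apply: continuous_compact; last exact: box_compact.
  apply: continuous_in_subspaceT => y /set_mem/box_img[p ip <-].
  exact: chart_inv_continuous.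
exists (chart_map j @` (dom j `&` ~` K)).
  exists q => //; split=> // -[y /box_img iy yq]; apply: niq.
  by rewrite -yq; exact: dom_chart_inv.
have oK := open_chart_image j (closed_openC cK).
apply: differentiable_upto_eq (differentiable_upto_cst oK n 0) => //.
move=> _ [p [jp Kp] <-]; rewrite /bump_field /= chart_mapK//.
case: asboolP => ip; last by rewrite scale0r.
rewrite bump_eq0 ?scale0r// => boxp; apply: Kp.
by exists (chart_map i p) => //; rewrite chart_mapK.
Qed.

Lemma vector_field_extension i p v : dom i p ->
  exists2 X : vectors M, vector_field X & X i p = v.
Proof.
move=> ip.
have [|r r0 box_img] := open_box (@img_open _ _ M i) (a := chart_map i p).
  by exists p.
(* The value of the bump at its centre is positive; dividing [v] by it makes the field equal to [v]
   at [p]. *)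
pose c := bumpfun (chart_map i p) r (chart_map i p).
exists (bump_field i (chart_map i p) r (c^-1 *: v)).
  exact: bump_field_vector_field.
rewrite /bump_field asboolT// derive_trans_id// scalerA divff ?scale1r//.
by rewrite gt_eqF// bump_center_gt0.
Qed.

End Charts.

(** * Symmetries of a Nijenhuis operator *)

Section Fields.
Variables (R : realType) (d : nat) (M : manifold R d).
Implicit Types (i j : chart M) (p : M) (X Y Z : vectors M) (A N : operators M).

Lemma smooth_components_eq (V : normedModType R) (T T' : components M V) :
  same_field T T' -> smooth_components T -> smooth_components T'.
Proof.
move=> TT' sT i k; apply: differentiable_upto_eq (sT i k).
  exact: img_open.
by move=> y /dom_chart_inv/TT'.
Qed.

Lemma smooth_components_op_apply A X :
  smooth_components A -> smooth_components X ->
  smooth_components (op_apply A X).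
Proof.
move=> sA sX i k; apply: differentiable_upto_mulmx (sA i k) (sX i k).
exact: img_open.
Qed.

Lemma vector_field_op_apply A X :
  operator_field A -> vector_field X -> vector_field (op_apply A X).
Proof.
move=> [sA tA] [sX tX]; split; first exact: smooth_components_op_apply.
by move=> i j p ip jp; rewrite /op_apply (tX i j)// !mulmxA tA.
Qed.

Lemma op_apply_pow0 N X : op_apply (op_pow N 0) X = X.
Proof. by apply/funext => i; apply/funext => p; exact: mul1mx. Qed.

Lemma op_apply_powS N k X :
  op_apply (op_pow N k.+1) X = op_apply N (op_apply (op_pow N k) X).
Proof.
apply/funext => i; apply/funext => p; rewrite /op_apply /op_pow exprS.
by rewrite mulmxA.
Qed.

Lemma vector_field_op_pow N k X :
  operator_field N -> vector_field X -> vector_field (op_apply (op_pow N k) X).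
Proof.
move=> oN vX; elim: k => [|k IH]; first by rewrite op_apply_pow0.
by rewrite op_apply_powS; exact: vector_field_op_apply.
Qed.

(* With [A = N^k] and [B = N], the vectors [s], [t], [u], [v], [w], [x] are the
   brackets [X, Y], [X, NY], [AX, Y], [BAX, NY], [BAX, Y] and [AX, NY]. *)
Lemma concomitant_step (A B : 'M[R]_d) (s t u v w x : 'cV[R]_d) :
  A *m B *m s + x - A *m t - B *m u = 0 ->
  B *m B *m u + v - B *m w - B *m x = 0 ->
  B *m A *m B *m s + v - B *m A *m t - B *m w = 0.
Proof.
move=> /(congr1 (mulmx B)) Bx <-; rewrite -[RHS]addr0 -[in RHS](mulmx0 _ B) -Bx.
rewrite !(mulmxDr, mulmxN) !mulmxA.
by apply/matrixP => a b; rewrite !mxE; ring.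
Qed.

(** Induction on [k]: [N] applied to the hypothesis for [X] and [Y] is added to the Nijenhuis
    identity for [N^k X] and [Y]. *)
Lemma concomitant_op_pow N k :
  operator_field N -> nijenhuis N -> concomitant_zero (op_pow N k) N.
Proof.
move=> oN nN X Y vX vY i p ip; elim: k => [|k IH].
  rewrite /concomitant op_apply_pow0 /op_pow expr0.
  rewrite -[1]/(1%:M) !mul1mx addrK.
  by rewrite subrr.
have := nN _ _ (vector_field_op_pow k oN vX) vY _ _ ip.
move: IH; rewrite /concomitant op_apply_powS /op_pow (exprS _ k) expr2.
exact: concomitant_step.
Qed.

Lemma symmetries_op_pow n N (k : 'I_n) :
  operator_field N -> nijenhuis N -> symmetries n N (op_pow N k).
Proof.
move=> oN nN; split; last exact: concomitant_op_pow.
exists (fun l => cst (l == k)%:R); split => [l i m|i p ip].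
  by apply: differentiable_upto_cst; exact: img_open.
rewrite /op_comb (bigD1 k)//= eqxx scale1r big1 ?addr0// => l /negbTE lk.
by rewrite lk scale0r.
Qed.

(** Members of [symmetries] get their smoothness from the expansion in powers of [N]; this makes the
    brackets with [op_apply A X] differentiable. *)
Lemma smooth_components_comb n N (h : 'I_n -> M -> R) A X :
  operator_field N -> (forall k, smooth_fun (h k)) ->
  same_field A (op_comb h (fun k => op_pow N k)) -> vector_field X ->
  smooth_components (op_apply A X).
Proof.
move=> oN sh AN vX.
pose T : vectors M := fun i p =>
  \sum_(k < n) h k p *: op_apply (op_pow N k) X i p.
apply: (@smooth_components_eq _ T) => [i p ip|i k].
  rewrite /op_apply AN// /op_comb mulmx_suml.
  by apply: eq_bigr => l _; rewrite scalemxAl.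
have oi := @img_open _ _ M i.
apply: (@differentiable_upto_sum _ _ _ oi _ _ _
  (fun l y =>
     h l (chart_inv i y) *: op_apply (op_pow N l) X i (chart_inv i y))) => l.
apply: differentiable_uptoZ => //; first exact: sh.
by have [+ _] := vector_field_op_pow l oN vX; apply.
Qed.

Lemma smooth_components_differentiable (V : normedModType R)
    (T : components M V) i p :
  smooth_components T -> dom i p ->
  differentiable (T i \o chart_inv i) (chart_map i p).
Proof. by move=> /(_ i 1%N)[+ _] ip; apply; exists p. Qed.

Lemma smooth_fun_differentiable (f : M -> R) i p : smooth_fun f -> dom i p ->
  differentiable (f \o chart_inv i : 'cV[R]_d -> R^o) (chart_map i p).
Proof. by move=> /(_ i 1%N)[+ _] ip; apply; exists p. Qed.

Lemma differentialE (f : M -> R) i p v : smooth_fun f -> dom i p ->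
  'D_v (f \o chart_inv i : 'cV[R]_d -> R^o) (chart_map i p)
  = (differential f i p *m v) 0 0.
Proof.
move=> sf ip; have df := smooth_fun_differentiable sf ip.
rewrite deriveE// [in LHS](matrix_sum_delta v) linear_sum mxE.
by apply: eq_bigr => l _; rewrite big_ord1 linearZ -deriveE// !mxE mulrC.
Qed.

End Fields.

(** * Pointwise linear algebra *)

Section CyclicFamily.
Variable R : numFieldType.

(** Self-adjointness with respect to [P] passes from [N] to every polynomial in [N]. *)
Lemma horner_mx_intertwine d (N P : 'M[R]_d.+1) p :
  N *m P = P *m N^T -> horner_mx N p *m P = P *m (horner_mx N p)^T.
Proof.
move=> NP; elim/poly_ind: p => [|p c IH].
  by rewrite rmorph0 trmx0 mul0mx mulmx0.
rewrite rmorphD rmorphM /= horner_mx_X horner_mx_C -mulmxE.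
rewrite mulmxDl linearD /= mulmxDr tr_scalar_mx scalar_mxC; congr (_ + _).
rewrite -mulmxA NP mulmxA IH -mulmxA -trmx_mul.
by congr (_ *m _^T); exact: comm_mx_horner.
Qed.

Lemma skew_mx11_eq0 (x : 'M[R]_1) : x^T = - x -> x = 0.
Proof.
move=> xN; apply/matrixP => i j; rewrite !ord1 mxE.
have /matrixP/(_ 0 0) := xN; rewrite !mxE => /eqP.
by rewrite -subr_eq0 opprK -mulr2n mulrn_eq0 => /eqP.
Qed.

(** The recursion, solved downwards from the last row [a], gives every row the form [a p(N)].
    Pairing two such rows gives [a (pq)(N) P a^T], the value of a skew form on a repeated
    argument. *)
Lemma cyclic_isotropic d n (N P : 'M[R]_d) (A : 'M[R]_(n.+1, d))
    (c : 'I_n.+1 -> R) :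
  P^T = - P -> N *m P = P *m N^T ->
  (forall l : 'I_n, row (lift ord0 l) A *m N
     = row (widen_ord (leqnSn n) l) A + c (lift ord0 l) *: row ord_max A) ->
  A *m P *m A^T = 0.
Proof.
(* [horner_mx] needs matrices of positive size; for [d = 0] the matrix [A] has no columns. *)
case: d N P A => [|d'] N P A P_skew NP Arec.
  by rewrite [A]thinmx0 !mul0mx.
pose a := row ord_max A.
have a_skew B : B *m P = P *m B^T -> a *m B *m P *m a^T = 0.
  move=> BP; apply: skew_mx11_eq0.
  by rewrite !trmx_mul trmxK P_skew mulNmx mulmxN (mulmxA P) -BP !mulmxA.
have A_poly (l : 'I_n.+1) : exists p, row l A = a *m horner_mx N p.
  (* Descending induction on the row index, starting from the last row with polynomial 1. *)
  have [m] := ubnP (n - l); elim: m l => // m IH l.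
  have [l_n _|l_n] := eqVneq (l : nat) n.
    exists 1; rewrite rmorph1 mulmx1; congr (row _ A); exact: val_inj.
  have ltln : (l < n)%N by rewrite ltn_neqAle l_n -ltnS ltn_ord.
  have := IH (lift ord0 (Ordinal ltln)); have := Arec (Ordinal ltln).
  rewrite (_ : widen_ord _ _ = l); last exact: val_inj.
  move=> + IHl lt_m; have [|p ->] := IHl.
    rewrite /= /bump /= add1n; move: lt_m; rewrite subnS.
    by case: (n - l)%N (subn_gt0 l n) => [|k] //; rewrite ltln.
  rewrite -mulmxA => Nrow.
  exists (p * 'X - (c (lift ord0 (Ordinal ltln)))%:P).
  rewrite rmorphB rmorphM /= horner_mx_X horner_mx_C mulmxBr mul_mx_scalar.
  by rewrite -mulmxE Nrow addrK.
apply/matrixP => i j; rewrite mxE.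
have [p rowi] := A_poly i; have [q rowj] := A_poly j.
have -> : \sum_l (A *m P) i l * A^T l j = (row i A *m P *m (row j A)^T) 0 0.
  by rewrite -row_mul mxE; apply: eq_bigr => l _; rewrite !mxE.
(* Moving [q(N)^T] across [P] merges both polynomials on the left, where [a_skew] applies to their
   product. *)
rewrite rowi rowj trmx_mul !mulmxA -(mulmxA _ P) -horner_mx_intertwine//.
rewrite !mulmxA -(mulmxA a) mulmxE -rmorphM.
by rewrite a_skew ?mxE//; exact: horner_mx_intertwine.
Qed.

(** The rows of [G] stand for the differentials of the coefficients. Replacing [G] by [H^T *m G]
    passes from the basis [Q] to the powers of [N], where comparing coefficients yields the
    recursion of [cyclic_isotropic]. *)
Lemma symmetry_gradients_isotropic d n (N P : 'M[R]_d) (G : 'M[R]_(n, d))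
    (Q : 'I_n -> 'M[R]_d) (c : 'I_n -> R) (H F : 'M[R]_n) :
  P^T = - P -> N *m P = P *m N^T ->
  free [tuple N ^+ k | k < n] ->
  N ^+ n = \sum_(l < n) c l *: N ^+ l ->
  (forall k, Q k = \sum_(l < n) H k l *: N ^+ l) ->
  (forall k : 'I_n, N ^+ k = \sum_(l < n) F k l *: Q l) ->
  (forall w : 'cV[R]_d, \sum_(k < n) (G *m w) k 0 *: (N *m Q k)
     = \sum_(k < n) (G *m (N *m w)) k 0 *: Q k) ->
  G *m P *m G^T = 0.
Proof.
move=> P_skew NP /freeP N_free Nn QH NF GN.
have indep (x y : 'I_n -> R) :
    \sum_(k < n) x k *: N ^+ k = \sum_(k < n) y k *: N ^+ k -> x =1 y.
  move=> xy k; apply/eqP; rewrite -subr_eq0; apply/eqP.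
  apply: (N_free (fun k => x k - y k)) => {k}.
  under eq_bigr => k _ do rewrite -tnth_nth tnth_mktuple scalerBl.
  by rewrite sumrB xy subrr.
(* Change of basis on coefficients; it is used with [B] equal to the identity and to [N]. *)
have sumH (x : 'cV[R]_n) (B : 'M[R]_d) : \sum_(k < n) x k 0 *: (B *m Q k)
    = \sum_(l < n) (H^T *m x) l 0 *: (B *m N ^+ l).
  under eq_bigr => k _ do rewrite QH mulmx_sumr scaler_sumr.
  rewrite exchange_big; apply: eq_bigr => l _ /=.
  rewrite mxE scaler_suml; apply: eq_bigr => k _.
  by rewrite -scalemxAr scalerA mxE mulrC.
(* Both sides give the coefficients of [N ^+ k] in the independent powers. As the matrices are
   square, [H *m F] is the identity too, so [G] is recovered from [A]. *)
have FH : F *m H = 1%:M.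
  apply/matrixP => k l; rewrite [RHS]mxE.
  pose e (l : 'I_n) : R := (k == l)%:R.
  apply: (indep (fun l => (F *m H) k l) e).
  transitivity (N ^+ k); last first.
    rewrite (bigD1 k)//= /e eqxx scale1r big1 ?addr0// => i /negbTE.
    by rewrite eq_sym => ->; rewrite scale0r.
  rewrite NF; transitivity (\sum_(i < n) (row k F)^T i 0 *: (1%:M *m Q i)).
    rewrite sumH; apply: eq_bigr => i _; rewrite mul1mx -trmx_mul.
    by rewrite -row_mul !mxE.
  by apply: eq_bigr => i _; rewrite mul1mx !mxE.
have [A AE] : exists A, A = H^T *m G by exists (H^T *m G).
have GE : G = F^T *m A by rewrite AE mulmxA -trmx_mul (mulmx1C FH) trmx1 mul1mx.
suff A0 : A *m P *m A^T = 0.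
  rewrite GE trmx_mul !mulmxA -(mulmxA F^T A) -(mulmxA F^T _ A^T) A0.
  by rewrite mulmx0 mul0mx.
case: n => [|n] in G Q c H F N_free Nn QH NF GN indep sumH FH A AE GE *.
  by rewrite [A]flatmx0 !mul0mx.
apply: (@cyclic_isotropic _ _ N _ _ c) => // l.
have AN (w : 'cV[R]_d) : \sum_(k < n.+1) (A *m w) k 0 *: (N *m N ^+ k)
    = \sum_(k < n.+1) (A *m (N *m w)) k 0 *: N ^+ k.
  rewrite AE -!mulmxA -sumH GN.
  rewrite -(eq_bigr _ (fun k _ => congr1 _ (mul1mx (Q k)))) sumH.
  by under eq_bigr do rewrite mul1mx.
have Arec (w : 'cV[R]_d) : (A *m (N *m w)) (lift ord0 l) 0
    = (A *m w) (widen_ord (leqnSn n) l) 0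
      + c (lift ord0 l) * (A *m w) ord_max 0.
  (* [y] lists the coefficients after multiplication by [N]: each index moves up by one, nothing
     reaches index 0, and the top power is reduced by [Nn], which adds [c k * x ord_max]. *)
  pose x k := (A *m w) k 0.
  pose y k :=
    (if unlift ord0 k is Some k' then x (widen_ord (leqnSn n) k') else 0)
    + c k * x ord_max.
  have -> : (A *m (N *m w)) (lift ord0 l) 0 = y (lift ord0 l).
    apply: (indep (fun k => (A *m (N *m w)) k 0) y).
    rewrite -AN big_ord_recr /=.
    under [RHS]eq_bigr do rewrite /y scalerDl.
    rewrite big_split /= [X in _ = X + _]big_ord_recl unlift_none scale0r add0r.
    congr (_ + _).
      by apply: eq_bigr => k _; rewrite liftK /x /= /bump /= add1n exprS.
    rewrite -[N *m _]exprS Nn scaler_sumr; apply: eq_bigr => k _.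
    by rewrite scalerA mulrC.
  by rewrite /y liftK.
apply/rowP => m.
have entry (r : 'rV[R]_d) : r 0 m = (r *m (delta_mx m 0 : 'cV[R]_d)) 0 0.
  by rewrite -colE mxE.
rewrite entry [RHS]entry mulmxDl -scalemxAl -mulmxA -!row_mul !mxE.
by have := Arec (delta_mx m 0); rewrite !mxE.
Qed.

End CyclicFamily.

(** * Leibniz' rule for the concomitant *)

Section Leibniz.
Variables (R : realType) (d n : nat) (M : manifold R d).
Implicit Types (i : chart M) (p : M) (X Y Z : vectors M) (S N : operators M).

(** The derivative of [Z] is linear in its direction, so only the derivative along [Z] meets the
    coefficients [f k]; it enters the bracket with a minus sign. *)
Lemma lie_bracket_comb S (f : 'I_n -> M -> R) (Q : 'I_n -> operators M)
    X Z i p :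
  dom i p -> (forall k, smooth_fun (f k)) -> same_field S (op_comb f Q) ->
  (forall k, smooth_components (op_apply (Q k) X)) -> smooth_components Z ->
  lie_bracket (op_apply S X) Z i p
  = \sum_(k < n) f k p *: lie_bracket (op_apply (Q k) X) Z i p
    - \sum_(k < n) (differential (f k) i p *m Z i p) 0 0 *: (Q k i p *m X i p).
Proof.
move=> ip sf SQ sQX sZ.
have dZ := smooth_components_differentiable sZ ip.
pose g k y : R^o := f k (chart_inv i y).
pose F k y := op_apply (Q k) X i (chart_inv i y).
have dg k : differentiable (g k) (chart_map i p).
  exact: smooth_fun_differentiable.
have dF k : differentiable (F k) (chart_map i p).
  exact: smooth_components_differentiable.
have SX_p : op_apply S X i p = \sum_(k < n) f k p *: op_apply (Q k) X i p.
  rewrite /op_apply SQ// mulmx_suml; apply: eq_bigr => k _.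
  by rewrite scalemxAl.
have dSX : 'D_(Z i p) (op_apply S X i \o chart_inv i) (chart_map i p)
    = \sum_(k < n) (g k (chart_map i p) *: 'D_(Z i p) (F k) (chart_map i p)
        + 'D_(Z i p) (g k) (chart_map i p) *: F k (chart_map i p)).
  have p_img : (chart_map i @` dom i) (chart_map i p) by exists p.
  have := open_nbhs_nbhs (conj (@img_open _ _ M i) p_img) => p_nbhs.
  (* [S] equals the combination on the chart domain, which is open, and this suffices for the
     derivative at the point. *)
  rewrite (@near_eq_derive _ _ _ _ (\sum_(k < n) (fun y => g k y *: F k y))).
    rewrite derive_sum => [|k].
      by apply: eq_bigr => k _; exact: derive_scale_mx.
    by apply: diff_derivable; exact: differentiable_scale_mx.
  apply: filterS p_nbhs => y iy; rewrite fct_sumE /= /op_apply SQ; last first.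
    exact: dom_chart_inv.
  by rewrite mulmx_suml; apply: eq_bigr => k _; rewrite -scalemxAl.
rewrite /lie_bracket dSX SX_p deriveE// linear_sum /= big_split /= opprD addrA.
congr (_ - _); last first.
  apply: eq_bigr => k _; rewrite /F chart_mapK//; congr (_ *: _).
  exact: differentialE.
rewrite -sumrB; apply: eq_bigr => k _.
by rewrite linearZ -deriveE// scalerBr /g chart_mapK.
Qed.

(** The algebra behind [concomitant_comb]: [s], [t], [u k], [v k] are the brackets [[X, Y]],
    [[X, NY]], [[Q_k X, NY]], [[Q_k X, Y]], while [b k] and [c k] are the differential of [f k] on
    [NY] and on [Y]. *)
Lemma concomitant_expand (N : 'M[R]_d) (Q : 'I_n -> 'M[R]_d) (a b c : 'I_n -> R)
    (s t x : 'cV[R]_d) (u v : 'I_n -> 'cV[R]_d) :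
  (\sum_(k < n) a k *: Q k) *m N *m s
    + (\sum_(k < n) a k *: u k - \sum_(k < n) b k *: (Q k *m x))
    - (\sum_(k < n) a k *: Q k) *m t
    - N *m (\sum_(k < n) a k *: v k - \sum_(k < n) c k *: (Q k *m x))
  = \sum_(k < n) a k *: (Q k *m N *m s + u k - Q k *m t - N *m v k)
    - \sum_(k < n) b k *: (Q k *m x) + \sum_(k < n) c k *: (N *m Q k *m x).
Proof.
rewrite !mulmx_suml mulmxBr opprB !mulmx_sumr -!sumrN -!big_split /=.
apply: eq_bigr => k _.
rewrite -!scalemxAl -!scalemxAr !mulmxA.
move: (Q k *m N *m s) (Q k *m t) (N *m v k) (Q k *m x) (N *m Q k *m x).
by move=> y1 y2 y3 y4 y5; apply/matrixP => i j; rewrite !mxE; ring.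
Qed.

(** Only [[SX, NY]] and [[SX, Y]] differentiate the coefficients. If [S] and all [Q k] are
    symmetries, what is left is the vanishing of the two correction sums. *)
Lemma concomitant_comb S N (f : 'I_n -> M -> R) (Q : 'I_n -> operators M)
    X Y i p :
  dom i p -> (forall k, smooth_fun (f k)) -> same_field S (op_comb f Q) ->
  (forall k, smooth_components (op_apply (Q k) X)) ->
  smooth_components Y -> smooth_components (op_apply N Y) ->
  concomitant S N X Y i p = \sum_(k < n) f k p *: concomitant (Q k) N X Y i p
    - \sum_(k < n) (differential (f k) i p *m (N i p *m Y i p)) 0 0
        *: (Q k i p *m X i p)
    + \sum_(k < n) (differential (f k) i p *m Y i p) 0 0
        *: (N i p *m Q k i p *m X i p).
Proof.
move=> ip sf SQ sQX sY sNY; rewrite /concomitant.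
rewrite (lie_bracket_comb ip sf SQ sQX sNY) (lie_bracket_comb ip sf SQ sQX sY).
rewrite SQ//; exact: concomitant_expand.
Qed.

End Leibniz.

(** * Poisson commutation of the coefficients *)

Theorem theorem4p1 (R : realType) (d n : nat) (M : manifold R d)
    (P : bivectors M) (N : operators M) (Q : 'I_n -> operators M)
    (P_poisson : poisson_structure P)
    (N_operator : operator_field N)
    (N_nijenhuis : nijenhuis N)
    (N_independent : powers_independent N n)
    (n_maximal : forall m : nat, powers_independent N m -> (m <= n)%N)
    (N_powers : forall k : nat, (n <= k)%N ->
       exists h : 'I_n -> M -> R, (forall l, smooth_fun (h l)) /\
         same_field (op_pow N k) (op_comb h (fun l => op_pow N l)))
    (Q_basis : symmetries_basis N Q)
    (N_self_adjoint : self_adjoint P N)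
    (S : operators M) (S_sym : symmetries n N S)
    (f : 'I_n -> M -> R) (f_smooth : forall k, smooth_fun (f k))
    (S_expansion : same_field S (op_comb f Q)) :
  forall (k l : 'I_n) (p : M), poisson_bracket P (f k) (f l) p = 0%R.
Proof.
move=> k l p; rewrite /poisson_bracket /pairing.
set i := chart_at p; have ip : dom i p := dom_chart_at p.
have [Q_sym Q_span] := Q_basis.
(* From here on all fields are evaluated at [p] in the single chart [i], and the coefficient
   functions become matrices of numbers. *)
have [H HE] : exists H : 'M[R]_n, forall k,
    Q k i p = \sum_l H k l *: N i p ^+ l.
  have /choice[h hE] k' := (Q_sym k').1.
  exists (\matrix_(a, b) h a b p) => a; rewrite (hE a).2//.
  by apply: eq_bigr => b _; rewrite mxE.
have [F FE] : exists F : 'M[R]_n, forall k : 'I_n,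
    N i p ^+ k = \sum_l F k l *: Q l i p.
  have /choice[h hE] (k' : 'I_n) :=
    Q_span _ (symmetries_op_pow k' N_operator N_nijenhuis).
  exists (\matrix_(a, b) h a b p) => a.
  have := (hE a).2 i p ip; rewrite /op_pow => ->.
  by apply: eq_bigr => b _; rewrite mxE.
have [c [_ cE]] := N_powers n (leqnn n).
have P_skew : (P i p)^T = - P i p by have [[_ _ /(_ i p ip)]] := P_poisson.
(* Self-adjointness on pairs of basis covectors, read as a matrix identity. *)
have NP : N i p *m P i p = P i p *m (N i p)^T.
  apply/matrixP => a b.
  have := N_self_adjoint i p ip (delta_mx 0 a) (delta_mx 0 b).
  have entry (A : 'M[R]_d) :
      (delta_mx 0 a *m A *m (delta_mx 0 b)^T : 'M[R]_1) 0 0 = A a b.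
    by rewrite trmx_delta -rowE -colE !mxE.
  rewrite /pairing /dual_apply trmx_mul !mulmxA -(mulmxA _ (P i p)) entry.
  by rewrite -(mulmxA _ (N i p)) entry.
pose G := \matrix_(a < n) differential (f a) i p.
have GPG : G *m P i p *m G^T = 0.
  apply: (symmetry_gradients_isotropic P_skew NP (N_independent i p ip)
    (cE i p ip) HE FE).
  move=> w.
  apply/matrixP => a b.
  have entry (A : 'M[R]_d) : A a b = (A *m (delta_mx b 0 : 'cV[R]_d)) a 0.
    by rewrite -colE mxE.
  rewrite entry [RHS]entry; congr (fun_of_matrix _ a 0).
  (* The operator identity is tested on column [b]. Global fields with the required values at [p]
     suffice, because the correction terms depend only on these values. *)
  have [X vX Xp] := vector_field_extension (delta_mx b 0) ip.
  have [Y vY Yp] := vector_field_extension w ip.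
  have sQX k' : smooth_components (op_apply (Q k') X).
    have [[h [sh QhE]] _] := Q_sym k'.
    exact: smooth_components_comb N_operator sh QhE vX.
  have := S_sym.2 _ _ vX vY i p ip.
  have [sNY _] := vector_field_op_apply N_operator vY.
  rewrite (concomitant_comb ip f_smooth S_expansion sQX vY.1 sNY) Xp Yp.
  rewrite big1 => [|k' _]; last by rewrite (Q_sym k').2// scaler0.
  rewrite add0r addrC => /eqP; rewrite subr_eq0 => /eqP SN.
  have diffE (u : 'cV[R]_d) k' :
      (differential (f k') i p *m u) 0 0 = (G *m u) k' 0.
    by rewrite !mxE; apply: eq_bigr => m _; rewrite !mxE.
  rewrite !mulmx_suml; transitivity
      (\sum_(k < n) (differential (f k) i p *m w) 0 0
         *: (N i p *m Q k i p *m (delta_mx b 0 : 'cV[R]_d))).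
    by apply: eq_bigr => k' _; rewrite diffE -scalemxAl.
  by rewrite SN; apply: eq_bigr => k' _; rewrite diffE -scalemxAl.
(* The entries of [G P G^T] are the brackets of the [f k] at [p]. *)
have /matrixP/(_ k l) := GPG; rewrite [RHS]mxE => <-.
rewrite [LHS]mxE [RHS]mxE; apply: eq_bigr => m _; rewrite !mxE; congr (_ * _).
by apply: eq_bigr => m' _; rewrite !mxE.
Qed.
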